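(* For every instance of the packing disjoint bilinear program (defined in the context), the linear programs (RLT-PDB) and (LP-PDB) defined in the context are equivalent, in the sense that their optimal values coincide: $z_{\mathrm{RLT\text{-}PDB}}=z_{\mathrm{LP\text{-}PDB}}$.
   Context: Packing disjoint bilinear program: $\max\{\mathbf x^T\mathbf y\mid\mathbf x\in\mathcal X,\mathbf y\in\mathcal Y\}$ with $\mathcal X=\{\mathbf x\in\mathbb R^n\mid\mathbf x\ge\mathbf 0,\ \mathbf P\mathbf x\le\mathbf p\}$ and $\mathcal Y=\{\mathbf y\in\mathbb R^n\mid\mathbf y\ge\mathbf 0,\ \mathbf Q\mathbf y\le\mathbf q\}$, where $\mathbf P\in\mathbb R_+^{m_1\times n}$, $\mathbf Q\in\mathbb R_+^{m_2\times n}$, $\mathbf p\in\mathbb R_+^{m_1}$, $\mathbf q\in\mathbb R_+^{m_2}$; $\mathcal X,\mathcal Y$ are polytopes (bounded). Let $\theta_i=\max_{\mathbf x\in\mathcal X}x_i$, $\gamma_i=\max_{\mathbf y\in\mathcal Y}y_i$, and let $\mathbf P_i,\mathbf Q_i$ denote the $i$-th columns of $\mathbf P,\mathbf Q$. (LP-PDB): $$z_{\mathrm{LP\text{-}PDB}}=\max_{\boldsymbol\omega\ge\mathbf 0}\Big\{\sum_{i=1}^n\theta_i\gamma_i\omega_i\ \Big|\ \sum_{i=1}^n\theta_i\mathbf P_i\omega_i\le\mathbf p,\ \sum_{i=1}^n\gamma_i\mathbf Q_i\omega_i\le\mathbf q\Big\}.$$ (RLT-PDB), a reformulation-linearization relaxation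 of the (rescaled) bilinear program, with variables $\mathbf x,\mathbf y\in\mathbb R^n$ and $\mathbf u=(u_{ij})\in\mathbb R^{n\times n}$: $$z_{\mathrm{RLT\text{-}PDB}}=\max\ \sum_{i=1}^n\theta_i\gamma_iu_{ii}$$ subject to $\sum_i\theta_i\mathbf P_ix_i\le\mathbf p$; $\ \sum_i\theta_i\mathbf P_iu_{ij}\le\mathbf p\,y_j$ for all $j$; $\ \sum_i\gamma_i\mathbf Q_iy_i\le\mathbf q$; $\ \sum_i\gamma_i\mathbf Q_iu_{ji}\le\mathbf q\,x_j$ for all $j$; $\ 0\le x_i\le1$, $0\le y_i\le1$ for all $i$; $\ 0\le u_{ij}\le y_j$ and $0\le u_{ji}\le x_j$ for all $i,j$. *)

(* Defs.v *)
From HB Require Import structures.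
From mathcomp Require Import all_boot all_order all_algebra.
From mathcomp Require Import all_classical all_reals all_analysis.

Set Implicit Arguments.
Unset Strict Implicit.
Unset Printing Implicit Defensive.

Import Order.TTheory GRing.Theory Num.Theory.
Import numFieldNormedType.Exports.

Local Open Scope classical_set_scope.
Local Open Scope ring_scope.

Definition is_max (R : realType) (A : set R) (z : R) : Prop :=
  A z /\ ubound A z.

(* The maximum of A; the default 0 is returned only if A has no maximum. *)
Definition maxval (R : realType) (A : set R) : R := xget 0 (is_max A).

(* Entrywise order; MathComp's matrices carry no canonical order. *)
Definition lemx (R : realType) (m n : nat) (A B : 'M[R]_(m, n)) : Prop :=
  forall i j, A i j <= B i j.

Notation "A <=m B" := (lemx A B) (at level 70, no associativity) : ring_scope.

Section PackingBilinear.
Variables (R : realType) (n : nat).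

Definition packing_set (m : nat) (A : 'M[R]_(m, n)) (b : 'cV[R]_m) :
    set 'cV[R]_n :=
  [set x | 0 <=m x /\ A *m x <=m b].

(* theta_i = coord_max P p i, gamma_i = coord_max Q q i *)
Definition coord_max (m : nat) (A : 'M[R]_(m, n)) (b : 'cV[R]_m) (i : 'I_n) :
    R :=
  maxval [set x i 0 | x in packing_set A b].

Variables (m1 m2 : nat) (P : 'M[R]_(m1, n)) (Q : 'M[R]_(m2, n)).
Variables (p : 'cV[R]_m1) (q : 'cV[R]_m2).

Let theta := coord_max P p.
Let gamma := coord_max Q q.

Definition LP_feasible (w : 'cV[R]_n) : Prop :=
  [/\ 0 <=m w,
      \sum_i (theta i * w i 0) *: col i P <=m p
    & \sum_i (gamma i * w i 0) *: col i Q <=m q].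

Definition LP_values : set R :=
  [set \sum_i theta i * gamma i * w i 0 | w in LP_feasible].

Definition z_LP : R := maxval LP_values.

Record RLT_feasible (x y : 'cV[R]_n) (u : 'M[R]_n) : Prop := {
  RLT_P  : \sum_i (theta i * x i 0) *: col i P <=m p;
  RLT_Pu : forall j, \sum_i (theta i * u i j) *: col i P <=m y j 0 *: p;
  RLT_Q  : \sum_i (gamma i * y i 0) *: col i Q <=m q;
  RLT_Qu : forall j, \sum_i (gamma i * u j i) *: col i Q <=m x j 0 *: q;
  RLT_x  : forall i, 0 <= x i 0 <= 1;
  RLT_y  : forall i, 0 <= y i 0 <= 1;
  RLT_uy : forall i j, 0 <= u i j <= y j 0;
  RLT_ux : forall i j, 0 <= u j i <= x j 0 }.

Definition RLT_values : set R :=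
  [set z | exists x y u, RLT_feasible x y u /\
                         z = \sum_i theta i * gamma i * u i i].

Definition z_RLT : R := maxval RLT_values.

End PackingBilinear.

(* Main.v *)
Require Import Defs.
From HB Require Import structures.
From mathcomp Require Import all_boot all_order all_algebra.
From mathcomp Require Import all_classical all_reals all_analysis.

Import Order.TTheory GRing.Theory Num.Theory.
Import numFieldNormedType.Exports.

Local Open Scope classical_set_scope.
Local Open Scope ring_scope.

(* The two linear programs attain exactly the same set of values. The diagonal
   of a feasible u is feasible for (LP-PDB), since u_ii is at most x_i and y_i.
   Conversely, a feasible w may be truncated to min(w_i, 1) without changing
   its value, because theta_i > 0 forces w_i <= 1; then x = y = w and
   u = diag(w) are feasible for (RLT-PDB), because the points theta_i e_i and
   gamma_i e_i belong to the two packing polytopes. After truncation (LP-PDB)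
   is a linear program over a compact set, so that the common maximum exists. *)

Section Packing.
Set Implicit Arguments.
Unset Strict Implicit.

Variable R : realType.

(** * Entrywise order, matrix form of the constraints, and linear forms *)

Lemma lemx_trans m n (A B C : 'M[R]_(m, n)) : A <=m B -> B <=m C -> A <=m C.
Proof. by move=> AB BC i j; exact: le_trans (AB i j) (BC i j). Qed.

Lemma lemx_mul2l m n k (A : 'M[R]_(m, n)) (B C : 'M[R]_(n, k)) :
  0 <=m A -> B <=m C -> A *m B <=m A *m C.
Proof.
move=> A0 BC i j; rewrite !mxE; apply: ler_sum => l _.
by apply: ler_wpM2l => //; have := A0 i l; rewrite mxE.
Qed.

Lemma sum_scale_col m n (A : 'M[R]_(m, n)) (t : 'I_n -> R) :
  \sum_i t i *: col i A = A *m \col_i t i.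
Proof.
apply/matrixP => i j; rewrite summxE mxE; apply: eq_bigr => k _.
by rewrite !mxE mulrC.
Qed.

Lemma maxvalP (A : set R) : (exists z, is_max A z) -> is_max A (maxval A).
Proof. by move=> ?; exact: xgetPex. Qed.

Lemma linear_form_continuous n (c : 'I_n -> R) :
  continuous (fun v : 'rV[R]_n => \sum_i c i * v 0 i).
Proof.
apply: (@continuous_big _ _ +%R 0 xpredT) => [|i _ v].
  exact: add_continuous.
by apply: continuousM; [exact: cst_continuous | exact: coord_continuous].
Qed.

(** * Packing polytopes and attainment of linear maxima *)

Lemma packing_set0 m n (A : 'M[R]_(m, n)) (b : 'cV[R]_m) :
  0 <=m b -> packing_set A b 0.
Proof. by move=> b0; split; [move=> i j | rewrite mulmx0]. Qed.

Lemma packing_setP m n (A : 'M[R]_(m, n)) (b : 'cV[R]_m) (x : 'cV[R]_n) :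
  packing_set A b x <->
  (forall i, 0 <= x i 0) /\ (forall k, \sum_i A k i * x i 0 <= b k 0).
Proof.
split=> [[x0 Ax]|[x0 Ax]]; split.
- by move=> i; have := x0 i 0; rewrite mxE.
- by move=> k; have := Ax k 0; rewrite mxE.
- by move=> i j; rewrite ord1 mxE.
- by move=> i j; rewrite ord1 mxE.
Qed.

(** Finitely many weak linear inequalities cut out a closed set; with the bound [M] it lies in the
    box [0, M]^n, so it is compact, and the extreme value theorem applies. *)
Lemma packing_linear_max m n (A : 'M[R]_(m, n)) (b : 'cV[R]_m)
    (c : 'I_n -> R) (M : R) :
  0 <=m b -> (forall x, packing_set A b x -> forall i, x i 0 <= M) ->
  exists2 x, packing_set A b x &
    forall y, packing_set A b y -> \sum_i c i * y i 0 <= \sum_i c i * x i 0.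
Proof.
move=> b0 AM.
have trE (f : 'I_n -> R) (v : 'rV[R]_n) :
    \sum_i f i * v^T i 0 = \sum_i f i * v 0 i.
  by apply: eq_bigr => i _; rewrite mxE.
(* The topology is handled on row vectors, the setting of [rV_compact]; the result is transposed
   back at the end. *)
pose S := [set v : 'rV[R]_n | packing_set A b v^T].
have Scl : closed S.
  have -> : S = \bigcap_i [set v : 'rV[R]_n | 0 <= v 0 i]
      `&` \bigcap_k [set v : 'rV[R]_n | \sum_i A k i * v 0 i <= b k 0].
    apply/seteqP; split=> v; rewrite /S /= packing_setP.
      move=> [v0 Av]; split=> i _ /=; first by have := v0 i; rewrite mxE.
      by rewrite -trE.
    move=> [v0 Av]; split=> i; first by rewrite mxE; exact: v0.
    by rewrite trE; exact: Av.
  apply: closedI; apply: closed_bigI => i _.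
    have /continuous_closedP := @coord_continuous R 1 n 0 i.
    by move=> /(_ [set x | 0 <= x]); apply; exact: closed_ge.
  have /continuous_closedP := @linear_form_continuous n (A i).
  by move=> /(_ [set x | x <= b i 0]); apply; exact: closed_le.
have Sco : compact S.
  apply: (@subclosed_compact _ _
    [set v : 'rV[R]_n | forall i, `[0, M]%classic (v ord0 i)]) => //.
    by apply: (@rV_compact R n (fun=> `[0, M]%classic)) => _; exact: segment_compact.
  move=> v Sv i; rewrite /= in_itv /=.
  have /packing_setP[v0 _] := Sv.
  by have := v0 i; have := AM _ Sv i; rewrite mxE => -> ->.
have S0 : S !=set0 by exists 0; rewrite /S /= trmx0; exact: packing_set0.
have cf : {within S, continuous (fun v : 'rV[R]_n => \sum_i c i * v 0 i)}.
  exact/continuous_subspaceT/linear_form_continuous.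
have [v /set_mem Sv vmax] := compact_EVT_max S0 Sco cf.
exists v^T => // y Ay; rewrite trE -(trmxK y) trE.
by apply: vmax; apply/mem_set; rewrite /S /= trmxK.
Qed.

Lemma bounded_set_entry n (X : set 'cV[R]_n) :
  bounded_set X -> exists M, forall x, X x -> forall i, x i 0 <= M.
Proof.
(* [bounded_set] provides a norm bound for each real strictly above [M0]; [M0 + 1] is one such
   real. *)
move=> [M0 [_ XM]]; exists (M0 + 1) => x Xx i.
have /= := XM (M0 + 1) (ltr_pwDr ltr01 (lexx _)) x Xx.
apply: le_trans; apply: le_trans (ler_norm _) _.
rewrite /Num.norm /= mx_normrE.
exact: (le_bigmax _ (fun ij => `|x ij.1 ij.2|) (i, ord0)).
Qed.

(** * Coordinate maxima of a packing polytope *)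

Section CoordMax.
Variables (m n : nat) (A : 'M[R]_(m, n)) (b : 'cV[R]_m).
Hypotheses (A_ge0 : 0 <=m A) (b_ge0 : 0 <=m b).
Hypothesis A_bounded : bounded_set (packing_set A b).

Lemma coord_maxP i :
  is_max [set x i 0 | x in packing_set A b] (coord_max A b i).
Proof.
apply: maxvalP; have [M AM] := bounded_set_entry A_bounded.
have sumE (y : 'cV[R]_n) : \sum_j (j == i)%:R * y j 0 = y i 0.
  rewrite (bigD1 i) //= eqxx mul1r big1 ?addr0 // => j /negPf ->.
  by rewrite mul0r.
have [x Ax xmax] := packing_linear_max (fun j => (j == i)%:R) b_ge0 AM.
exists (x i 0); split; first by exists x.
by move=> _ [y Ay <-]; have := xmax y Ay; rewrite !sumE.
Qed.

Lemma coord_max_ge0 i : 0 <= coord_max A b i.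
Proof.
have [_ ub] := coord_maxP i; apply: ub; exists 0; last by rewrite mxE.
exact: packing_set0.
Qed.

(** At a maximizer x, the vector x_i A_i is one of the nonnegative terms of A x, and A x is at most
    b. *)
Lemma coord_max_col i : coord_max A b i *: col i A <=m b.
Proof.
have [[x [x0 Ax] <-] _] := coord_maxP i => k j.
rewrite ord1; apply: le_trans (Ax k 0); rewrite !mxE (bigD1 i) //= mulrC lerDl.
apply: sumr_ge0 => l _; apply: mulr_ge0.
  by have := A_ge0 k l; rewrite mxE.
by have := x0 l 0; rewrite mxE.
Qed.

(** The point c e_i lies in the packing set, and its i-th coordinate is c. *)
Lemma coord_max_scale_le i (c : R) :
  0 <= c -> c *: col i A <=m b -> c <= coord_max A b i.
Proof.
move=> c0 cA; have [_ ub] := coord_maxP i; apply: ub.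
exists (c *: delta_mx i 0); last by rewrite !mxE !eqxx mulr1.
split=> [k j|]; last by rewrite -scalemxAr -colE.
by rewrite !mxE mulr_ge0.
Qed.

(** Dropping the nonnegative terms j != i leaves (theta_i w_i) A_i <= b, hence theta_i w_i <=
    theta_i, and the positive theta_i cancels. *)
Lemma coord_max_weight_le1 (w : 'cV[R]_n) i : 0 < coord_max A b i ->
  0 <=m w -> \sum_j (coord_max A b j * w j 0) *: col j A <=m b -> w i 0 <= 1.
Proof.
move=> t0 w0 Aw.
have wE0 j : 0 <= w j 0 by have := w0 j 0; rewrite mxE.
suff : coord_max A b i * w i 0 <= coord_max A b i by rewrite ger_pMr.
apply: coord_max_scale_le; first by rewrite mulr_ge0 // ltW.
apply: lemx_trans Aw => k j; rewrite (bigD1 i) //= [leRHS]mxE lerDl summxE.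
apply: sumr_ge0 => l _; rewrite !mxE mulr_ge0 //.
  by rewrite mulr_ge0 // coord_max_ge0.
by have := A_ge0 k l; rewrite mxE.
Qed.

(** Needed both for truncating w and for passing from x or y to the diagonal of u. *)
Lemma coord_max_weightS (v w : 'cV[R]_n) : v <=m w ->
  \sum_j (coord_max A b j * w j 0) *: col j A <=m b ->
  \sum_j (coord_max A b j * v j 0) *: col j A <=m b.
Proof.
move=> vw; rewrite !sum_scale_col; apply: lemx_trans.
apply: lemx_mul2l => // i j; rewrite !mxE.
by rewrite ler_wpM2l ?coord_max_ge0.
Qed.

(** Here [u] is a row or a column of diag(w): the sum collapses to w_j (theta_j A_j), and
    [coord_max_col] bounds it. One statement serves both families of product constraints. *)
Lemma coord_max_diag (w : 'cV[R]_n) (u : 'I_n -> R) j :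
  0 <=m w -> (forall i, i != j -> u i = 0) -> u j = w j 0 ->
  \sum_i (coord_max A b i * u i) *: col i A <=m w j 0 *: b.
Proof.
move=> w0 u0 uj; rewrite (bigD1 j) //= big1 => [|i /u0 ->]; last first.
  by rewrite mulr0 scale0r.
rewrite addr0 uj mulrC -scalerA => k l.
rewrite [leLHS]mxE [leRHS]mxE ler_wpM2l //; last exact: coord_max_col.
by have := w0 j 0; rewrite mxE.
Qed.

End CoordMax.

(** * Comparison of the two linear programs *)

Section LinearPrograms.
Variables (n m1 m2 : nat) (P : 'M[R]_(m1, n)) (Q : 'M[R]_(m2, n)).
Variables (p : 'cV[R]_m1) (q : 'cV[R]_m2).
Hypotheses (P_ge0 : 0 <=m P) (Q_ge0 : 0 <=m Q).
Hypotheses (p_ge0 : 0 <=m p) (q_ge0 : 0 <=m q).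
Hypotheses (X_bounded : bounded_set (packing_set P p)).
Hypotheses (Y_bounded : bounded_set (packing_set Q q)).

Let theta := coord_max P p.
Let gamma := coord_max Q q.

Lemma LP_feasible_le1 w : LP_feasible P Q p q w ->
  exists2 v, LP_feasible P Q p q v & (forall i, v i 0 <= 1) /\
    \sum_i theta i * gamma i * v i 0 = \sum_i theta i * gamma i * w i 0.
Proof.
move=> [w0 Pw Qw]; pose v : 'cV[R]_n := \col_i Num.min (w i 0) 1.
have vw : v <=m w by move=> i j; rewrite ord1 mxE ge_min lexx.
exists v; first split.
- by move=> i j; rewrite !mxE le_min ler01 andbT; have := w0 i 0; rewrite mxE.
- exact: coord_max_weightS vw Pw.
- exact: coord_max_weightS vw Qw.
split=> [i|]; first by rewrite mxE ge_min lexx orbT.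
apply: eq_bigr => i _; rewrite mxE.
have := coord_max_ge0 p_ge0 X_bounded i.
(* Where theta_i = 0, truncation may change w_i, but the objective term vanishes on both sides. *)
rewrite le_eqVlt => /orP[/eqP t0|t0].
  by rewrite /theta -t0 !mul0r.
by rewrite min_l //; apply: coord_max_weight_le1 t0 w0 Pw.
Qed.

Lemma RLT_valuesE : RLT_values P Q p q = LP_values P Q p q.
Proof.
apply/seteqP; split=> z.
  move=> [x [y [u [[Px _ Qy _ _ _ uy ux] ->]]]].
  exists (\col_i u i i); last by apply: eq_bigr => i _; rewrite mxE.
  split.
  - by move=> i j; rewrite !mxE; case/andP: (uy i i).
  - apply: coord_max_weightS Px => // i j.
    by rewrite ord1 mxE; case/andP: (ux i i).
  - apply: coord_max_weightS Qy => // i j.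
    by rewrite ord1 mxE; case/andP: (uy i i).
move=> [w /LP_feasible_le1[v [v0 Pv Qv] [v1 vw]] <-].
have vE0 i : 0 <= v i 0 by have := v0 i 0; rewrite mxE.
exists v, v, (diag_mx v^T); split; last first.
  by rewrite -vw; apply: eq_bigr => i _; rewrite !mxE eqxx mulr1n.
have uE i j : (diag_mx v^T) i j = v i 0 *+ (i == j) by rewrite !mxE.
split=> //.
- move=> j; apply: coord_max_diag => // [i /negPf ij|]; rewrite uE ?ij //.
  by rewrite eqxx.
- move=> j; apply: coord_max_diag => // [i|]; rewrite uE ?eqxx // eq_sym.
  by move=> /negPf ->.
- by move=> i; rewrite vE0 v1.
- by move=> i; rewrite vE0 v1.
- by move=> i j; rewrite uE; have [->|_] := eqVneq i j; rewrite !vE0 ?lexx.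
- by move=> i j; rewrite uE; have [->|_] := eqVneq j i; rewrite !vE0 ?lexx.
Qed.

(** (LP-PDB) itself may be unbounded as a set: w_i is unconstrained above when theta_i = gamma_i =
    0. Adding w <= 1 as an identity block turns it into a bounded packing polytope, with stacked
    rows P diag(theta), Q diag(gamma), I and right-hand side p, q, 1. *)
Lemma LP_values_max : exists z, is_max (LP_values P Q p q) z.
Proof.
pose D (t : 'I_n -> R) := diag_mx (\row_i t i).
pose A := col_mx (col_mx (P *m D theta) (Q *m D gamma)) 1%:M.
pose b : 'cV[R]_(m1 + m2 + n) := col_mx (col_mx p q) (const_mx 1).
have DE t (w : 'cV[R]_n) : D t *m w = \col_i (t i * w i 0).
  by apply/matrixP => i j; rewrite ord1 mul_diag_mx !mxE.
have col_le k l (x y : 'cV[R]_k) (x' y' : 'cV[R]_l) :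
    col_mx x x' <=m col_mx y y' <-> x <=m y /\ x' <=m y'.
  split=> [h|[h h'] i j].
    split=> i j; [have := h (lshift l i) j | have := h (rshift k i) j].
      by rewrite !col_mxEu.
    by rewrite !col_mxEd.
  by rewrite -(splitK i); case: (fintype.split i) => i' /=;
    rewrite ?col_mxEu ?col_mxEd.
have packE w : packing_set A b w <->
    LP_feasible P Q p q w /\ forall i, w i 0 <= 1.
  rewrite /packing_set /LP_feasible /= /A /b !mul_col_mx !col_le mul1mx.
  rewrite -!mulmxA !DE -!sum_scale_col.
  split=> [[w0 [[Pw Qw] w1]]|[[w0 Pw Qw] w1]].
    by split=> // i; have := w1 i 0; rewrite mxE.
  by split=> //; split=> // i j; rewrite ord1 mxE.
have b0 : 0 <=m b.
  rewrite -col_mx0 -col_mx0; apply/col_le; split; first exact/col_le.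
  by move=> i j; rewrite !mxE.
have [||w /packE[Fw w1] wmax] :=
  @packing_linear_max _ _ A b (fun i => theta i * gamma i) 1 => //.
  by move=> x /packE[].
exists (\sum_i theta i * gamma i * w i 0); split; first by exists w.
(* Truncation keeps the value, so the maximum over the truncated set bounds all values of
   (LP-PDB). *)
move=> _ [v /LP_feasible_le1[v' Fv' [v'1 <-]] <-].
by apply: wmax; apply/packE.
Qed.

End LinearPrograms.
End Packing.

Theorem mainTheorem5 (R : realType) (n m1 m2 : nat)
    (P : 'M[R]_(m1, n)) (Q : 'M[R]_(m2, n))
    (p : 'cV[R]_m1) (q : 'cV[R]_m2)
    (P_ge0 : 0 <=m P) (Q_ge0 : 0 <=m Q) (p_ge0 : 0 <=m p) (q_ge0 : 0 <=m q)
    (X_bounded : bounded_set (packing_set P p))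
    (Y_bounded : bounded_set (packing_set Q q)) :
  [/\ is_max (RLT_values P Q p q) (z_RLT P Q p q),
      is_max (LP_values P Q p q) (z_LP P Q p q)
    & z_RLT P Q p q = z_LP P Q p q].
Proof.
have LPmax : is_max (LP_values P Q p q) (z_LP P Q p q).
  exact/maxvalP/LP_values_max.
by rewrite /z_RLT RLT_valuesE.
Qed.
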